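(* Let $p$ be a prime and let $G$ be a group of order $p^n$. Then $G$ contains a border multiplicative matching of cardinality at least $p^n/2^n$.
   Context: A border multiplicative matching of cardinality $m$ in a group $G$ is given by three sequences $((s_i,a_i))_{i=1}^m$, $((t_j,b_j))_{j=1}^m$, $((u_k,c_k))_{k=1}^m$ of elements of $G\times\mathbb{Z}$ such that for all $i,j,k$: (1) ($s_it_ju_k=1$ and $a_i+b_j+c_k=0$) if and only if $i=j=k$; and (2) $s_it_ju_k=1$ implies $a_i+b_j+c_k\ge0$. *)

(* Defs.v *)
From HB Require Import structures.
From mathcomp Require Import all_boot all_order all_algebra all_fingroup.
Set Implicit Arguments.
Unset Strict Implicit.
Unset Printing Implicit Defensive.

(* The three sequences are s, t, u : 'I_m -> gT * int; the group component of a
   term is its first projection and the integer weight its second. *)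
Definition border_mult_matching (gT : finGroupType) (G : {group gT}) (m : nat)
    (s t u : 'I_m -> gT * int) : Prop :=
  [/\ forall i : 'I_m, [/\ (s i).1 \in G, (t i).1 \in G & (u i).1 \in G],
      forall i j k : 'I_m,
        ((s i).1 * (t j).1 * (u k).1 = 1)%g /\
        ((s i).2 + (t j).2 + (u k).2 = 0)%R <-> i = j /\ j = k
    & forall i j k : 'I_m,
        ((s i).1 * (t j).1 * (u k).1 = 1)%g ->
        (0 <= (s i).2 + (t j).2 + (u k).2)%R].

Definition contains_border_mult_matching (gT : finGroupType) (G : {group gT})
    (m : nat) : Prop :=
  exists s t u : 'I_m -> gT * int, border_mult_matching G s t u.

(* Main.v *)
Require Import Defs.
From HB Require Import structures.
From mathcomp Require Import all_boot all_order all_algebra all_fingroup.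
From mathcomp Require Import all_solvable.
From mathcomp Require Import zify ring.
Set Implicit Arguments.
Unset Strict Implicit.
Unset Printing Implicit Defensive.

(** A cyclic group <[x]> of order p has the border matching
    (x^i, i^2), (x^i, i^2), (x^-2i, -2i^2) for 0 <= i < p/2: in that range
    i + j = 2k mod p forces i + j = 2k, and then the total weight
    i^2 + j^2 - 2k^2 is (i - j)^2 / 2.  Border matchings of a normal subgroup H
    and of G / H combine to one of G whose cardinality is the product, so the
    bound follows by induction along normal subgroups of order p. *)

Import Order.TTheory GRing.Theory Num.Theory.

(** Arbitrary finite index types allow a product matching to be indexed by pairs. *)
Definition border_matching_on (gT : finGroupType) (G : {group gT})
    (I : finType) (s t u : I -> gT * int) : Prop :=
  [/\ forall i, [/\ (s i).1 \in G, (t i).1 \in G & (u i).1 \in G],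
      forall i j k,
        ((s i).1 * (t j).1 * (u k).1 = 1)%g /\
        ((s i).2 + (t j).2 + (u k).2 = 0)%R <-> i = j /\ j = k
    & forall i j k,
        ((s i).1 * (t j).1 * (u k).1 = 1)%g ->
        (0 <= (s i).2 + (t j).2 + (u k).2)%R].

Lemma border_matching_on_card (gT : finGroupType) (G : {group gT})
    (I : finType) (s t u : I -> gT * int) :
  border_matching_on G s t u -> contains_border_mult_matching G #|I|.
Proof.
case=> inG diag ge0.
exists (s \o enum_val), (t \o enum_val), (u \o enum_val); split=> /=.
- by move=> i; apply: inG.
- move=> i j k; split; first by case/diag=> /enum_val_inj-> /enum_val_inj->.
  by case=> -> ->; apply/diag.
- by move=> i j k; apply: ge0.
Qed.

Lemma contains_border_mult_matching_cyclic (gT : finGroupType) (x : gT) :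
  contains_border_mult_matching <[x]>%G (uphalf #[x]%g).
Proof.
pose w (i : 'I_(uphalf #[x]%g)) : int := (i * i)%:Z%R.
pose s (i : 'I_(uphalf #[x]%g)) := ((x ^+ i)%g, w i).
pose u (i : 'I_(uphalf #[x]%g)) := ((x ^- (2 * i)%N)%g, (- (2 * w i))%R).
exists s, s, u.
have prod1 (i j k : 'I_(uphalf #[x]%g)) :
    (x ^+ i * x ^+ j * x ^- (2 * k)%N = 1)%g <-> i + j = 2 * k.
  rewrite -expgD; split=> [/(canRL (mulgK _))|->]; last by rewrite mulgV.
  rewrite invgK mul1g => /eqP; rewrite eq_expg_mod_order.
  (* Indices below [uphalf #[x]] are at most [(#[x] - 1) / 2], so [i + j] and [2 * k] are both less
     than [#[x]], and their congruence modulo [#[x]] is an equality. *)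
  have [[ltin ltjn] ltkn] := (ltn_ord i, ltn_ord j, ltn_ord k).
  rewrite (modn_small (m := i + j)); last by lia.
  by rewrite modn_small; [move/eqP | lia].
split=> [i | i j k | i j k]; rewrite /s /u /w /=.
- by rewrite groupV !mem_cycle.
- rewrite prod1; split=> [[sum_ij sum0]|[-> ->]]; last by split; lia.
  have eq_ij : i = j :> nat by nia.
  by split; apply: ord_inj; lia.
- by rewrite prod1 => sum_ij; have := sqr_ge0 (i%:Z - j%:Z)%R; nia.
Qed.

(** Integrality gives [1 <= A], hence [N * A >= N > -B]. *)
Lemma mulrDabs_gt0 (N : nat) (A B : int) :
  (`|B| < N)%N -> (0 < A)%R -> (0 < N%:Z * A + B)%R.
Proof. nia. Qed.

(** Weights compare lexicographically. A trivial product in [G] maps to one in [G / H], whose weight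
    is nonnegative. If it is positive, it decides the sign of the total. If it is zero, the three
    indices over [G / H] coincide, and the question reduces to the matching of [H]. *)
Lemma contains_border_mult_matching_quotient (gT : finGroupType)
    (H G : {group gT}) (m1 m2 : nat) :
  (H <| G)%g -> contains_border_mult_matching (G / H)%G m1 ->
  contains_border_mult_matching H m2 ->
  contains_border_mult_matching G (m1 * m2).
Proof.
move=> nHG [a [b [c [abcG abc_diag abc_ge0]]]].
move=> [x [y [z [xyzH xyz_diag xyz_ge0]]]].
pose wH (q : 'I_m2 * 'I_m2 * 'I_m2) : int :=
  ((x q.1.1).2 + (y q.1.2).2 + (z q.2).2)%R.
pose N := (\max_q `|wH q|).+1.
have ltN i j k : (`|((x i).2 + (y j).2 + (z k).2)%R| < N)%N.
  by rewrite ltnS; apply: (leq_bigmax (i, j, k)).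
have reprG (g : coset_of H) : g \in (G / H)%g -> repr g \in G.
  move=> gG; rewrite -(quotientGK nHG).
  by rewrite mem_morphpre ?repr_coset_norm //= coset_reprK.
have HG := subsetP (normal_sub nHG).
have NG := subsetP (normal_norm nHG).
have cosetH h : h \in H -> coset H h = 1%g by move=> hH; apply: coset_id.
pose a' i := repr (a i).1; pose b' i := repr (b i).1.
have aG i : a' i \in G by apply: reprG; case: (abcG i).
have bG i : b' i \in G by apply: reprG; case: (abcG i).
have xH i : (x i).1 \in H by case: (xyzH i).
have yH i : (y i).1 \in H by case: (xyzH i).
have zH i : (z i).1 \in H by case: (xyzH i).
have xG i := HG _ (xH i); have yG i := HG _ (yH i); have zG i := HG _ (zH i).
(* With these lifts a product over one index of G / H is conjugate to x y z, and
   the factor N makes the weights in G / H dominate those in H. *)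
pose s (q : 'I_m1 * 'I_m2) :=
  ((a' q.1 * (x q.2).1)%g, (N%:Z * (a q.1).2 + (x q.2).2)%R).
pose t (q : 'I_m1 * 'I_m2) :=
  (((y q.2).1 * b' q.1)%g, (N%:Z * (b q.1).2 + (y q.2).2)%R).
pose u (q : 'I_m1 * 'I_m2) :=
  (((b' q.1)^-1 * (z q.2).1 * (a' q.1)^-1)%g,
   (N%:Z * (c q.1).2 + (z q.2).2)%R).
(* The diagonal condition determines [c] from [a] and [b], so [u] lifts [c] through the inverses of
   [a'] and [b'], which cancel exactly in [G]; an independent representative of [c] would leave a
   stray factor in [H]. *)
have c_eq i : (c i).1 = ((b i).1^-1 * (a i).1^-1)%g.
  have [+ _] := (abc_diag i i i).2 (conj erefl erefl).
  by move=> /(canRL (mulKg _)); rewrite mulg1 invMg.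
have prod_quo i1 i2 i3 j1 j2 j3 :
    ((s (i1, j1)).1 * (t (i2, j2)).1 * (u (i3, j3)).1 = 1)%g ->
    ((a i1).1 * (b i2).1 * (c i3).1 = 1)%g.
  move/(congr1 (coset H)) => /=.
  rewrite !morphM ?morphV ?(groupM, groupV, NG, aG, bG, xG, yG, zG) //=.
  rewrite (cosetH _ (xH _)) (cosetH _ (yH _)) (cosetH _ (zH _)) !coset_reprK.
  by rewrite !mulg1 mul1g -c_eq morph1.
have prod_diag i j1 j2 j3 :
    ((s (i, j1)).1 * (t (i, j2)).1 * (u (i, j3)).1 = 1)%g <->
    ((x j1).1 * (y j2).1 * (z j3).1 = 1)%g.
  have -> : ((s (i, j1)).1 * (t (i, j2)).1 * (u (i, j3)).1 =
             ((x j1).1 * (y j2).1 * (z j3).1) ^ (a' i)^-1)%g.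
    by rewrite /s /t /u /conjg /= invgK !mulgA mulgK.
  by split=> [/eqP|->]; rewrite ?conj1g // conjg_eq1 => /eqP.
have weight q1 q2 q3 : ((s q1).2 + (t q2).2 + (u q3).2 =
    N%:Z * ((a q1.1).2 + (b q2.1).2 + (c q3.1).2) +
    ((x q1.2).2 + (y q2.2).2 + (z q3.2).2))%R by rewrite /=; ring.
have -> : m1 * m2 = #|{: 'I_m1 * 'I_m2}| by rewrite card_prod !card_ord.
apply: (@border_matching_on_card _ _ _ s t u); split.
- by move=> q; split; rewrite /= ?(groupM, groupV).
- move=> [i1 j1] [i2 j2] [i3 j3]; split; last first.
    case=> -[-> ->] [-> ->]; rewrite prod_diag weight /=.
    have [_ ->] := (abc_diag i3 i3 i3).2 (conj erefl erefl).
    have [-> ->] := (xyz_diag j3 j3 j3).2 (conj erefl erefl).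
    by rewrite mulr0.
  case=> prod1; have quo1 := prod_quo _ _ _ _ _ _ prod1.
  rewrite weight /= => sum0.
  (* A positive quotient weight would make the total weight positive, against [sum0]. *)
  have quo0 : ((a i1).2 + (b i2).2 + (c i3).2 = 0)%R.
    have := abc_ge0 _ _ _ quo1; rewrite le_eqVlt => /predU1P[-> // | ].
    by move/(mulrDabs_gt0 (ltN j1 j2 j3)); rewrite sum0 ltxx.
  have [ei ei'] := (abc_diag i1 i2 i3).1 (conj quo1 quo0); subst i1 i2.
  move: sum0; rewrite quo0 mulr0 add0r => sum0.
  have prodH := (prod_diag _ _ _ _).1 prod1.
  by have [-> ->] := (xyz_diag j1 j2 j3).1 (conj prodH sum0).
- move=> [i1 j1] [i2 j2] [i3 j3] prod1; have quo1 := prod_quo _ _ _ _ _ _ prod1.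
  rewrite weight /=; have := abc_ge0 _ _ _ quo1.
  rewrite le_eqVlt => /predU1P[quo0|].
    have [ei ei'] := (abc_diag i1 i2 i3).1 (conj quo1 (esym quo0)); subst i1 i2.
    by rewrite -quo0 mulr0 add0r; apply/xyz_ge0/prod_diag/prod1.
  by move/(mulrDabs_gt0 (ltN j1 j2 j3)); apply: ltW.
Qed.

Lemma contains_border_mult_matching_pgroup (p n : nat) (gT : finGroupType)
    (G : {group gT}) :
  prime p -> #|G| = p ^ n -> contains_border_mult_matching G (uphalf p ^ n).
Proof.
move=> p_pr; elim: n gT G => [|n IHn] gT G oG.
  pose e := fun _ : 'I_1 => (1%g : gT, 0%R : int).
  exists e, e, e; split=> [i | i j k | i j k]; rewrite /e /= ?group1 //.
  by rewrite !mulg1 !addr0 !ord1.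
have pG : (p.-group G)%g by rewrite /pgroup oG pnatX pnat_id.
(* A nontrivial p-group has a normal subgroup of order [p ^ 1]. *)
have [|H [sHG nHG]] := @normal_pgroup p _ 1 G G pG (normal_refl G).
  by rewrite oG pfactorK.
rewrite expn1 => oH; rewrite expnSr.
apply: (contains_border_mult_matching_quotient nHG).
  apply: IHn; rewrite card_quotient ?normal_norm // -divgS // oG oH expnS.
  by rewrite mulKn // prime_gt0.
have /cyclicP[x defH] : (cyclic H)%g by apply: prime_cyclic; rewrite oH.
have -> : H = <[x]>%G by apply: val_inj.
rewrite -oH defH; exact: contains_border_mult_matching_cyclic.
Qed.

Theorem theoremA6 (p n : nat) (gT : finGroupType) (G : {group gT}) :
  prime p -> #|G| = (p ^ n)%N ->
  exists m : nat,
    (((p ^ n)%N%:R / (2 ^ n)%N%:R : rat) <= m%:R)%R /\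
    contains_border_mult_matching G m.
Proof.
move=> p_pr oG; exists (uphalf p ^ n); split; last first.
  exact: contains_border_mult_matching_pgroup.
rewrite ler_pdivrMr ?ltr0n ?expn_gt0 // -natrM ler_nat -expnMn.
(* What remains is [p <= uphalf p * 2] raised to the power [n]; [leq_exp2r] needs a positive
   exponent, hence the case split. *)
by case: n {oG} => // n; rewrite leq_exp2r //; lia.
Qed.
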